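(* Let $B$ be a real matrix with $M$ rows in $\mathbb{R}^N$, where either (Gauss-Seidel case) $B=A^{1/2}$ for a symmetric positive definite $A\in\mathbb{R}^{N\times N}$ (so $M=N$ and $\Phi_1=B^TB=A$), or (Kaczmarz case) $B=A$ for some $A\in\mathbb{R}^{M\times N}$ with $M\ge N$ (so $\Phi_1=B^TB=A^TA$). For $n\ge1$ let $\Phi_n$ be the total quasi projector and $\mathrm{vol}_n$ the sum of squared volumes over all choices of $n$ rows of $B$. Then for every $n>1$, $$\Phi_n=\Phi_1\left(\mathrm{vol}_{n-1}\,I-\Phi_{n-1}\right).$$
   Context: $I$ is the $N\times N$ identity and $A^{1/2}$ is the symmetric positive definite square root of $A$. The index $i$, $1\le i\le\binom{M}{n}$, enumerates the $n$-element subsets of the row indices $\{1,\dots,M\}$ of $B$; $B_n(i)\in\mathbb{R}^{n\times N}$ is the submatrix of $B$ formed by the rows in the $i$-th subset, and $G_n(i)=B_n(i)B_n(i)^T$. The squared volume is $v_n^2(i)=\det G_n(i)$ (the square of the $n$-volume of the parallelepiped formed by the chosen rows). The quasi projector is $Q_n(i)=B_n(i)^T\,\mathrm{adj}(G_n(i))\,B_n(i)$, where $\mathrm{adj}$ denotes the adjugate matrix (the adjugate of a $1\times1$ matrix is $1$). The total quasi projector is $\Phi_n:=\sum_{i=1}^{\binom{M}{n}}Q_n(i)$, and $\mathrm{vol}_n:=\sum_{i=1}^{\binom{M}{n}}v_n^2(i)$. *)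

(* Defs.v *)
From HB Require Import structures.
From mathcomp Require Import all_boot all_order all_algebra.

Set Implicit Arguments.
Unset Strict Implicit.
Unset Printing Implicit Defensive.

Import Order.TTheory GRing.Theory Num.Theory.
Local Open Scope ring_scope.

Definition posdefmx (R : rcfType) (N : nat) (A : 'M[R]_N) : Prop :=
  A^T = A /\ (forall x : 'cV[R]_N, x != 0 -> 0 < (x^T *m A *m x) 0 0).

(* [sqrtmx A B] reads "B = A^{1/2}".  For symmetric positive definite A such a
   B exists (the base field is real closed) and is unique. *)
Definition sqrtmx (R : rcfType) (N : nat) (A B : 'M[R]_N) : Prop :=
  posdefmx B /\ B *m B = A.

Section QuasiProjectors.
Variables (R : rcfType) (M N : nat) (B : 'M[R]_(M, N)).
Implicit Types (S : {set 'I_M}) (n : nat).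

(* The n-element row subsets are indexed by the sets S with #|S| = n rather
   than by 1, ..., 'C(M, n); the chosen rows are kept in increasing order. *)
Definition subrows S : 'M[R]_(#|S|, N) := rowsub (fun k => enum_val k) B.

Definition gram S : 'M[R]_#|S| := subrows S *m (subrows S)^T.

Definition vol2 S : R := \det (gram S).

Definition quasi_proj S : 'M[R]_N :=
  (subrows S)^T *m \adj (gram S) *m subrows S.

Definition total_quasi_proj n : 'M[R]_N :=
  \sum_(S : {set 'I_M} | #|S| == n) quasi_proj S.

(* For n > M there is no n-element row subset, so both sums vanish. *)
Definition total_vol n : R := \sum_(S : {set 'I_M} | #|S| == n) vol2 S.

End QuasiProjectors.

(* Main.v *)
(** Put [C = 'X *: B^T B] over the polynomial ring.  The sum of the principal minors [det K_S], weighted by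
    ['X^#|S|], is [det (1 + 'X *: K)]; for [K = B B^T] this is [det (1 + C)].
    By the matrix determinant lemma the entries of [quasi_proj B S] are the
    changes of the minor [det (B B^T)_S] when [B B^T] becomes
    [B (1 + delta_mx b a) B^T], so the weighted sum of the quasi projectors is
    [C *m \adj (1 + C)].  Since [(1 + C) *m \adj (1 + C) = (det (1 + C))%:M],
    this is [C *m (vol - Phi)] for the two generating functions [vol] and
    [Phi], and the theorem compares the coefficients of ['X^n]. *)
Require Import Defs.
From mathcomp Require Import all_boot all_order all_algebra.

Import Order.TTheory GRing.Theory Num.Theory.
Local Open Scope ring_scope.

(** [U *m D] and [D *m U] have equal determinants. Both are block lower triangular, with diagonal
    blocks an identity and [1%:M + A *m B], respectively [1%:M + B *m A]. *)
Lemma det_1addmxC (R : comNzRingType) (m n : nat)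
    (A : 'M[R]_(m, n)) (B : 'M[R]_(n, m)) :
  \det (1%:M + A *m B) = \det (1%:M + B *m A).
Proof.
pose D : 'M_(m + n) := block_mx 1%:M (- A) B 1%:M.
pose U : 'M_(m + n) := block_mx 1%:M A 0 1%:M.
have dU : \det U = 1 by rewrite det_ublock !det1 mulr1.
transitivity (\det (U *m D)).
  rewrite mulmx_block !(mul1mx, mulmx1, mul0mx, add0r) addNr det_lblock det1.
  by rewrite mulr1.
rewrite det_mulmx mulrC -det_mulmx mulmx_block.
rewrite !(mul1mx, mulmx1, mulmx0, addr0) subrr det_lblock det1 mul1r.
by rewrite addrC.
Qed.

(** The bordered matrix [D] has determinant [\det (A + u *m v)]. Multiplied by a block matrix of
    determinant [\det A], it becomes block triangular with determinant [\det A] times the right-hand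
    side; regularity cancels [\det A]. *)
Lemma det_addmx_col_row_lreg (R : comNzRingType) (n : nat) (A : 'M[R]_n)
    (u : 'cV[R]_n) (v : 'rV[R]_n) :
  GRing.lreg (\det A) ->
  \det (A + u *m v) = \det A + (v *m \adj A *m u) 0 0.
Proof.
move=> regA.
pose D : 'M_(n + 1) := block_mx A u (- v) 1%:M.
have -> : \det (A + u *m v) = \det D.
  transitivity (\det (D *m (block_mx 1%:M 0 v 1%:M : 'M_(n + 1)))).
    rewrite mulmx_block !(mulmx1, mul1mx, mulmx0, add0r) addNr.
    by rewrite det_ublock det1 mulr1.
  by rewrite det_mulmx det_lblock !det1 !mulr1.
apply: regA.
have <- : \det (block_mx 1%:M (- (\adj A *m u)) 0 (\det A)%:M : 'M_(n + 1))
          = \det A.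
  by rewrite det_ublock det1 mul1r det_scalar1.
rewrite mulrC -det_mulmx mulmx_block !(mulmx1, mulmx0, addr0).
rewrite mulmxN mulmxA mul_mx_adj mul_scalar_mx mul_mx_scalar addNr.
rewrite mulmxN mulNmx opprK mul_mx_scalar scalemx1.
rewrite det_lblock det_ublock det1 mul1r det_scalar1 det_mx11 mulmxA [in RHS]addrC.
by rewrite mxE [in X in _ + X]mxE mulr1n.
Qed.

Lemma det_addmx_col_row (R : comNzRingType) (n : nat) (A : 'M[R]_n)
    (u : 'cV[R]_n) (v : 'rV[R]_n) :
  \det (A + u *m v) = \det A + (v *m \adj A *m u) 0 0.
Proof.
(* Deform [A] to ['X%:M + A], whose determinant is monic, hence regular. *)
pose P := char_poly_mx (- A).
have regP : GRing.lreg (\det P).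
  by apply/lreg_lead; rewrite (monicP (char_poly_monic _)); apply: lreg1.
have P0 : map_mx (horner_eval 0) P = A.
  apply/matrixP=> i j.
  by rewrite !mxE /= horner_evalE !hornerE hornerMn hornerX mul0rn sub0r opprK.
have ev m k (X : 'M[R]_(m, k)) : map_mx (horner_eval 0) (map_mx polyC X) = X.
  by apply/matrixP=> i j; rewrite !mxE /= horner_evalE hornerC.
have := det_addmx_col_row_lreg _ _ P (map_mx polyC u) (map_mx polyC v) regP.
move/(congr1 (horner_eval 0)).
rewrite rmorphD -!det_map_mx map_mxD map_mxM !ev P0 => ->; congr (_ + _).
transitivity (map_mx (horner_eval 0)
  (map_mx polyC v *m \adj P *m map_mx polyC u) 0 0); first by rewrite [RHS]mxE.
by rewrite !map_mxM map_mx_adj P0 !ev.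
Qed.

Lemma det_1addmx_minors (R : comNzRingType) (m : nat) (K : 'M[R]_m) :
  \det (1%:M + K) =
  \sum_(S : {set 'I_m})
    \det (mxsub (@enum_val _ (mem S)) (@enum_val _ (mem S)) K).
Proof.
(* [L S] has the rows of [K] in [S] and those of the identity elsewhere; its
   determinant is the minor of [S] by [det_1addmxC]. *)
pose L (S : {set 'I_m}) : 'M[R]_m :=
  \matrix_(i, j) (if i \in S then K i j else (1%:M : 'M_m) i j).
transitivity (\sum_(S : {set 'I_m}) \det (L S)).
  (* In each Leibniz term the product over the rows of [K + 1%:M] is expanded; [S] collects the rows
     where the entry of [K] is chosen. *)
  rewrite /determinant exchange_big; apply: eq_bigr => s _ /=.
  rewrite -big_distrr /=; congr (_ * _).
  under eq_bigr do rewrite mxE addrC.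
  rewrite bigA_distr; apply: eq_bigr => S _; apply: eq_bigr => i _.
  by rewrite [RHS]mxE.
apply: eq_bigr => S _.
pose e := @enum_val _ (mem S).
pose E : 'M[R]_(#|S|, m) := rowsub e 1%:M.
(* [E^T *m E] is the diagonal projector onto the coordinates in [S], so [K - 1%:M] is added in these
   rows only. After the swap, [E *m E^T = 1%:M] leaves [E *m K *m E^T]. *)
have -> : L S = 1%:M + E^T *m (E *m (K - 1%:M)).
  apply/matrixP=> i j; rewrite -rowsubE !mxE.
  under eq_bigr do rewrite !mxE.
  rewrite -(big_enum_val (fun k => (k == i)%:R * (K k j - (k == j)%:R))) /=.
  case: ifP => iS.
    rewrite (bigD1 i) //= eqxx mul1r big1 ?addr0 ?subrKC // => k /andP[_ kDi].
    by rewrite (negbTE kDi) mul0r.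
  rewrite big1 ?addr0 // => k kS.
  by case: eqP => [ki|_]; rewrite ?mul0r //; rewrite -ki kS in iS.
rewrite det_1addmxC.
have EE : E *m E^T = 1%:M.
  by apply/matrixP=> i j; rewrite -rowsubE !mxE eq_sym (inj_eq enum_val_inj).
congr determinant.
rewrite mulmxBr mulmx1 mulmxBl EE addrC subrK.
have -> : E^T = colsub e 1%:M by rewrite /E trmx_mxsub trmx1.
by rewrite -rowsubE mulmx_colsub mulmx1 -mxsubcr.
Qed.

Lemma det_1addXmx_minors (R : comNzRingType) (m : nat) (K : 'M[R]_m) :
  \det (1%:M + 'X *: map_mx polyC K) =
  \sum_(S : {set 'I_m})
    \det (mxsub (@enum_val _ (mem S)) (@enum_val _ (mem S)) K) *: 'X^#|S|.
Proof.
rewrite det_1addmx_minors; apply: eq_bigr => S _.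
by rewrite linearZ /= detZ -map_mxsub det_map_mx mulrC mul_polyC.
Qed.

Section Generating.
Variables (R : rcfType) (M N : nat) (B : 'M[R]_(M, N)).

Let C : 'M[{poly R}]_N := 'X *: map_mx polyC (B^T *m B).

Lemma gramE (S : {set 'I_M}) :
  gram B S = mxsub (@enum_val _ (mem S)) (@enum_val _ (mem S)) (B *m B^T).
Proof. by rewrite /gram /subrows trmx_mxsub mxsub_mul. Qed.

Lemma sum_vol2_poly :
  \sum_(S : {set 'I_M}) vol2 B S *: 'X^#|S| = \det (1%:M + C).
Proof.
under eq_bigr do rewrite /vol2 gramE.
rewrite -det_1addXmx_minors /C !map_mxM scalemxAl det_1addmxC.
by rewrite scalemxAr.
Qed.

(** The perturbation has rank one: column [b] of [B] times row [a] of [B^T]. The row factor stands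
    on the left in [v *m \adj A *m u], hence [delta_mx b a] for the entry [a b]. *)
Lemma quasi_projE (S : {set 'I_M}) (a b : 'I_N) :
  quasi_proj B S a b =
  \det (mxsub (@enum_val _ (mem S)) (@enum_val _ (mem S))
         (B *m (1%:M + delta_mx b a) *m B^T)) - vol2 B S.
Proof.
have -> : B *m (1%:M + delta_mx b a) *m B^T
          = B *m B^T + col b B *m row a B^T.
  rewrite mulmxDr mulmx1 mulmxDl colE rowE mulmxA.
  by rewrite -(mul_delta_mx (0 : 'I_1)) !mulmxA.
rewrite linearD /= -gramE mxsub_mul.
have -> : rowsub (@enum_val _ (mem S)) (col b B) = col b (subrows B S).
  by apply/matrixP=> i j; rewrite !mxE.
have -> : colsub (@enum_val _ (mem S)) (row a B^T) = row a (subrows B S)^T.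
  by apply/matrixP=> i j; rewrite !mxE.
rewrite det_addmx_col_row /vol2 addrC addKr.
transitivity (col b (row a (quasi_proj B S)) 0 0); first by rewrite !mxE.
by rewrite !rowE !colE !mulmxA.
Qed.

Lemma sum_quasi_proj_poly :
  \sum_(S : {set 'I_M}) 'X^#|S| *: map_mx polyC (quasi_proj B S)
  = C *m \adj (1%:M + C).
Proof.
apply/matrixP=> a b; rewrite summxE.
under eq_bigr do rewrite mxE [X in _ * X]mxE quasi_projE polyCB mulrBr
  !(mulrC 'X^_) !mul_polyC.
rewrite sumrB -det_1addXmx_minors sum_vol2_poly.
(* Moving [B] to the right end gives an [N] by [N] determinant, again a rank-one update, now of
   [1%:M + C]; the determinant lemma applies a second time. *)
rewrite -mulmxA map_mxM scalemxAr det_1addmxC -scalemxAl -map_mxM.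
have -> : 'X *: map_mx polyC ((1%:M + delta_mx b a) *m B^T *m B)
          = C + delta_mx b 0 *m (delta_mx (0 : 'I_1) a *m C).
  rewrite -mulmxA mulmxDl mul1mx map_mxD scalerDr (map_mxM _ (delta_mx b a)).
  by rewrite map_delta_mx mulmxA mul_delta_mx scalemxAr.
rewrite addrA det_addmx_col_row [LHS]addrC addKr -(mulmxA _ C).
by rewrite -rowE -colE mxE [LHS]mxE.
Qed.

Lemma total_quasi_proj_poly (n : nat) :
  total_quasi_proj B n = map_mx (coefp n) (C *m \adj (1%:M + C)).
Proof.
rewrite -sum_quasi_proj_poly raddf_sum /= /total_quasi_proj big_mkcond /=.
apply: eq_bigr => S _; apply/matrixP=> i j.
rewrite [RHS]mxE mxE [X in _ * X]mxE /= coefMC coefXn eq_sym.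
by case: eqP; rewrite ?mul1r // mul0r mxE.
Qed.

Lemma total_vol_poly (n : nat) : total_vol B n = (\det (1%:M + C))`_n.
Proof.
rewrite -sum_vol2_poly coef_sum /total_vol big_mkcond /=.
apply: eq_bigr => S _; rewrite coefZ coefXn eq_sym.
by case: eqP; rewrite ?mulr1 // mulr0.
Qed.

Lemma total_quasi_projS (n : nat) :
  total_quasi_proj B n.+1 =
  B^T *m B *m ((total_vol B n)%:M - total_quasi_proj B n).
Proof.
have adjE : \adj (1%:M + C) = (\det (1%:M + C))%:M - C *m \adj (1%:M + C).
  by rewrite -mul_mx_adj mulmxDl mul1mx addrK.
rewrite total_quasi_proj_poly {1}adjE total_vol_poly total_quasi_proj_poly.
set D := \det _; set P := C *m \adj _.
apply/matrixP=> i j.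
(* The factor ['X] of [C] lowers the degree by one: coefficient [n.+1] on the left meets coefficient
   [n] of [D%:M - P]. *)
rewrite [LHS]mxE {1}/C -scalemxAl [X in coefp _ X]mxE /= mulrC coefMX /=.
rewrite !mxE coef_sum; apply: eq_bigr => k _.
by rewrite mxE coefCM !mxE coefB coefMn.
Qed.

Lemma total_quasi_proj0 : total_quasi_proj B 0 = 0.
Proof.
rewrite total_quasi_proj_poly; apply/matrixP=> i j.
by rewrite mxE /C -scalemxAl !mxE /= mulrC coefMX.
Qed.

(** The constant coefficient is the value at [0], where [C] vanishes and the identity matrix
    remains. *)
Lemma total_vol0 : total_vol B 0 = 1.
Proof.
rewrite total_vol_poly -horner_coef0 -[_.[0]]/(horner_eval 0 _) -det_map_mx.
rewrite (_ : map_mx _ _ = 1%:M) ?det1 //; apply/matrixP=> i j.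
by rewrite !mxE /= horner_evalE hornerD hornerM hornerX mul0r addr0 hornerMn hornerC.
Qed.

(** This is the recursion at [n = 0], started by the empty row subset. *)
Lemma total_quasi_proj1 : total_quasi_proj B 1 = B^T *m B.
Proof.
by rewrite total_quasi_projS total_quasi_proj0 total_vol0 subr0 mulmx1.
Qed.

Lemma total_quasi_proj_rec (n : nat) :
  (0 < n)%N ->
  total_quasi_proj B n =
  total_quasi_proj B 1 *m ((total_vol B n.-1)%:M - total_quasi_proj B n.-1).
Proof. by case: n => // n _; rewrite total_quasi_proj1 total_quasi_projS. Qed.

End Generating.

Theorem theorem1 (R : rcfType) :
  (* Gauss-Seidel case: B = A^{1/2} *)
  (forall (N : nat) (A B : 'M[R]_N),
     posdefmx A -> sqrtmx A B ->
     [/\ total_quasi_proj B 1 = B^T *m B,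
         B^T *m B = A
       & forall n : nat, (1 < n)%N ->
           total_quasi_proj B n =
           total_quasi_proj B 1 *m
             ((total_vol B n.-1)%:M - total_quasi_proj B n.-1)]) /\
  (* Kaczmarz case: B = A *)
  (forall (M N : nat) (A B : 'M[R]_(M, N)),
     (N <= M)%N -> B = A ->
     [/\ total_quasi_proj B 1 = B^T *m B,
         B^T *m B = A^T *m A
       & forall n : nat, (1 < n)%N ->
           total_quasi_proj B n =
           total_quasi_proj B 1 *m
             ((total_vol B n.-1)%:M - total_quasi_proj B n.-1)]).
Proof.
split=> [N A B _ [[trB _] BB] | M N A B _ ->].
  split=> [||n n_gt1]; first exact: total_quasi_proj1.
    (* [B] is symmetric by [posdefmx], so [B^T *m B] is [B *m B = A]. *)
    by rewrite trB.
  exact: total_quasi_proj_rec (ltnW n_gt1).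
split=> // [|n n_gt1]; first exact: total_quasi_proj1.
exact: total_quasi_proj_rec (ltnW n_gt1).
Qed.
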